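(* For $k\in\mathbb{N}$ let $E(k)=\#\{n\in\mathbb{Z}: 0\le n\le k,\ \chi(n)=0\}$. Then $\lim_{k\to\infty}E(k)/k=1$.
   Context: $f_0=f_1=1$, $f_i=f_{i-1}+f_{i-2}$ ($i\ge2$). The integers $\chi(n)$, $n\in\mathbb{N}$, are defined by $\prod_{i\ge1}(1-x^{f_i})=\sum_{n\ge0}\chi(n)x^n$; equivalently $\chi(n)=\sum_h(-1)^hF_h(n)$, where $F_h(n)$ is the number of ways to write $n$ as a sum of $h$ Fibonacci numbers $f_{i_1}+\dots+f_{i_h}$ with $1\le i_1<\dots<i_h$. *)

(* Defs.v *)
From HB Require Import structures.
From mathcomp Require Import all_boot all_order all_algebra.

Set Implicit Arguments.
Unset Strict Implicit.
Unset Printing Implicit Defensive.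

Import Order.TTheory GRing.Theory Num.Theory.

Local Open Scope ring_scope.

(* Shifted indexing: f_0 = f_1 = 1. *)
Fixpoint fib (i : nat) : nat :=
  if i is j.+1 then (if j is l.+1 then (fib j + fib l)%N else 1%N) else 1%N.

Definition fib_prod (N : nat) : {poly int} :=
  \prod_(1 <= i < N.+1) (1 - 'X^(fib i)).

(* Since i <= f_i, the factors with i > n do not affect the coefficient of
   x^n in the infinite product; see fib_prod_stable. *)
Definition chi (n : nat) : int := (fib_prod n)`_n.

(* Subsets A of {1, ..., n} (shifted to 'I_n) of cardinal h such that the
   f_i, i in A, sum to n; larger i cannot occur as f_i > n. *)
Definition fib_rep (h n : nat) : nat :=
  #|[set A : {set 'I_n} | (#|A| == h) && (\sum_(i in A) fib i.+1 == n)%N]|.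

Definition chi_zeros (k : nat) : nat := #|[set n : 'I_k.+1 | chi n == 0]|.

Lemma leq_fib i : (i <= fib i)%N.
Proof.
suff: (i <= fib i)%N /\ (i.+1 <= fib i.+1)%N by case.
elim: i => [|[|i] [IH1 IH2]] //; split=> //.
by rewrite -[leqLHS]addn1; apply: leq_add => //; apply: leq_trans IH1.
Qed.

Lemma fib_prod_stable n N : (n <= N)%N -> (fib_prod N)`_n = chi n.
Proof.
elim: N => [|N IH]; first by rewrite leqn0 => /eqP->.
rewrite leq_eqVlt => /predU1P[-> //|ltnN]; rewrite -(IH ltnN) /fib_prod.
rewrite big_nat_recr //= mulrBr mulr1 coefB coefMXn.
by rewrite (leq_trans _ (leq_fib N.+1)) ?subr0 // ltnW.
Qed.

Lemma chi_fib_rep n : chi n = \sum_(h < n.+1) (-1) ^+ h * (fib_rep h n)%:R.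
Proof.
rewrite /chi /fib_prod big_add1 big_mkord.
rewrite (eq_bigr (fun i : 'I_n => - 'X^(fib i.+1) + 1)); last first.
  by move=> i _; rewrite addrC.
rewrite bigA_distr coef_sum.
transitivity (\sum_(A : {set 'I_n})
  (if (\sum_(i in A) fib i.+1 == n)%N then (-1) ^+ #|A| else 0 : int)).
  apply: eq_bigr => A _; rewrite -big_mkcond /= prodrN prodrXr.
  rewrite -[X in X * _]signr_odd -[in RHS]signr_odd mulr_sign.
  by case: odd; rewrite ?coefN coefXn (eq_sym n); case: eqP.
rewrite -big_mkcond /=.
rewrite (partition_big (fun A : {set 'I_n} => inord #|A| : 'I_n.+1) xpredT) //=.
apply: eq_bigr => h _.
have cardE (A : {set 'I_n}) : (inord #|A| == h :> 'I_n.+1) = (#|A| == h).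
  by rewrite -val_eqE /= inordK // ltnS -[leqRHS](card_ord n) max_card.
under eq_bigl do rewrite cardE.
rewrite (eq_bigr (fun=> (-1) ^+ h)); last by move=> A /andP[_ /eqP->].
rewrite sumr_const mulr_natr; congr (_ *+ _).
by rewrite /fib_rep cardsE; apply: eq_card => A; rewrite unfold_in andbC.
Qed.

(* Main.v *)
Require Import Defs.
From HB Require Import structures.
From mathcomp Require Import all_boot all_order all_algebra.
From mathcomp Require Import all_classical all_reals all_analysis.
From mathcomp Require Import zify ring lra.

Set Implicit Arguments.
Unset Strict Implicit.
Unset Printing Implicit Defensive.

Import Order.TTheory GRing.Theory Num.Theory.
Import numFieldNormedType.Exports.
Local Open Scope classical_set_scope.
Local Open Scope ring_scope.

(** The finite products of the factors [1 - x^(fib i)] are palindromic up to sign,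
    so removing the one or two largest parts of a representation gives
    [chi (fib k.+2 + r) = - chi r - (-1)^k chi (fib k.+1 - 2 - r)].
    Applied twice, this shows that the block of values of [chi] between two
    consecutive Fibonacci numbers [f_m] and [f_(m+1)] consists, up to three
    exceptional places, of a signed reversed copy of the first [f_(m-3)] values, a
    run of zeros, and a copy of those same values. Hence the number [a_m] of nonzero
    values below [f_m] satisfies [a_(m+1) <= a_m + 2 a_(m-3) + 3], and grows at a
    rate below [31/20], while [f_m] grows at a rate above [8/5]. *)

(** * Degree and symmetry of the finite products *)

Local Arguments fib : simpl never.

Lemma fibSS n : fib n.+2 = (fib n.+1 + fib n)%N.
Proof. by []. Qed.

Lemma fib_gt0 n : (0 < fib n)%N.
Proof. by elim: n => [|[|n] IH] //; rewrite fibSS addn_gt0 IH. Qed.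

Lemma fib_homo : {homo fib : m n / (m <= n)%N}.
Proof.
apply: homo_leq => [n||[|n]] //; first exact: leq_trans.
by rewrite fibSS leq_addr.
Qed.

Lemma coef_fib_prodS N j : (fib_prod N.+1)`_j =
  (fib_prod N)`_j - (if (j < fib N.+1)%N then 0 else (fib_prod N)`_(j - fib N.+1)).
Proof. by rewrite /fib_prod big_nat_recr //= mulrBr mulr1 coefB coefMXn. Qed.

(** The degree of [fib_prod N] is f_1 + ... + f_N = f_(N+2) - 2. *)
Lemma coef_fib_prod_gt N j : (fib N.+2 <= j.+1)%N -> (fib_prod N)`_j = 0.
Proof.
elim: N j => [|N IH] j.
  by rewrite /fib_prod big_geq // coef1; case: j.
rewrite coef_fib_prodS !fibSS => hj; have := fib_gt0 N.
rewrite !IH ?fibSS; [by case: ifP; rewrite subrr|lia..].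
Qed.

(** Each factor 1 - x^d changes sign when its coefficients are reversed, and there are [N]
    factors. *)
Lemma coef_fib_prod_sym N i j : (i + j + 2 = fib N.+2)%N ->
  (fib_prod N)`_i = (-1) ^+ N * (fib_prod N)`_j.
Proof.
elim: N i j => [|N IH] i j.
  rewrite (_ : fib 2 = 2) // => hij.
  have [-> ->] : i = 0%N /\ j = 0%N by lia.
  by rewrite mul1r.
rewrite fibSS => hij; rewrite !coef_fib_prodS exprS.
(* Reflection in [fib_prod N] exchanges the two terms of [coef_fib_prodS]; their opposite signs give
   the extra factor -1. *)
have half a b : (a + b + 2 = fib N.+2 + fib N.+1)%N ->
    (fib_prod N)`_a = (-1) ^+ N * (if (b < fib N.+1)%N then 0
                                   else (fib_prod N)`_(b - fib N.+1)).
  move=> hab; case: ltnP => hb.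
    by rewrite mulr0 coef_fib_prod_gt //; lia.
  by apply: IH; lia.
rewrite (half i j) // (half j i) //; last by lia.
by rewrite mulN1r mulNr mulrBr signrMK opprB.
Qed.

(** * Reflection identities for [chi] *)

(** The factors with index above [N] only affect exponents from [fib N.+1] on; here [N] may be far
    smaller than [n]. *)
Lemma chi_coef N n : (n < fib N.+1)%N -> chi n = (fib_prod N)`_n.
Proof.
move=> hn; rewrite -(fib_prod_stable (leq_maxr N n)).
have : (N <= maxn N n)%N by exact: leq_maxl.
elim: (maxn N n) => [|M IH]; first by rewrite leqn0 => /eqP->.
rewrite leq_eqVlt => /predU1P[-> //|ltNM].
rewrite coef_fib_prodS IH // (leq_trans hn) ?subr0 //.
by apply: fib_homo; lia.
Qed.

(* A representation of [fib k.+2 + r] without the part [fib k.+2] must use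
   [fib k.+1]; the rest is counted by [fib_prod k], which is palindromic up to
   sign. *)
Lemma chi_fib_add k r s : (r + s + 2 = fib k.+1)%N ->
  chi (fib k.+2 + r) = - chi r - (-1) ^+ k * chi s.
Proof.
move=> hrs.
have hk : (fib k.+2 = fib k.+1 + fib k)%N by [].
rewrite (@chi_coef k.+2); last by rewrite (fibSS k.+1); lia.
rewrite !coef_fib_prodS.
rewrite (@chi_coef k r); last by lia.
rewrite (@chi_coef k s); last by lia.
rewrite -(@coef_fib_prod_sym k (fib k + r)); last by lia.
rewrite (@coef_fib_prod_gt k (fib k.+2 + r)); last by lia.
have -> : (fib k.+2 + r < fib k.+1)%N = false by lia.
have -> : (fib k.+2 + r < fib k.+2)%N = false by lia.
have -> : (fib k.+2 + r - fib k.+1 = fib k + r)%N by lia.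
rewrite addKn ifT; last by lia.
ring.
Qed.

(** Two uses of [chi_fib_add] produce [chi t] twice, with opposite signs. *)
Lemma chi_right_block p s t : (s + t + 2 = fib p.+2)%N ->
  chi (fib p.+4.+1 + (fib p.+3 + s)) = chi s.
Proof.
move=> hst; rewrite (@chi_fib_add p.+3 _ t); last by rewrite (fibSS p.+2); lia.
by rewrite (@chi_fib_add p.+1 s t) // !exprS; ring.
Qed.

Lemma chi_left_block p r s : (r + s + 2 = fib p.+2)%N ->
  chi (fib p.+4.+1 + r) = (-1) ^+ p.+1 * chi s.
Proof.
move=> hrs; rewrite (@chi_fib_add p.+3 r (fib p.+3 + s)); last first.
  by rewrite (fibSS p.+2); lia.
rewrite (@chi_fib_add p.+1 s r); last by lia.
by rewrite !exprS -signr_odd; case: odd; rewrite ?expr0 ?expr1; ring.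
Qed.

(** Both terms of the first reduction lie just above [fib p.+2]; reducing each gives [chi s] and
    [chi t] twice, with opposite signs. *)
Lemma chi_middle_block p s t : (s + t + 2 = fib p.+1)%N ->
  chi (fib p.+4.+1 + (fib p.+2 + s)) = 0.
Proof.
move=> hst; rewrite (@chi_fib_add p.+3 _ (fib p.+2 + t)); last first.
  by rewrite (fibSS p.+2) (fibSS p.+1); lia.
rewrite (@chi_fib_add p s t) // (@chi_fib_add p t s); last by lia.
by rewrite !exprS -signr_odd; case: odd; rewrite ?expr0 ?expr1; ring.
Qed.

(** * Counting the nonzero values *)

Definition chi_nonzeros (n : nat) : nat := \sum_(i < n) (chi i != 0).

Lemma chi_nonzeros_homo : {homo chi_nonzeros : m n / (m <= n)%N}.
Proof.
move=> m n hmn; rewrite -(subnKC hmn) /chi_nonzeros big_split_ord /=.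
exact: leq_addr.
Qed.

Lemma chi_nonzerosD m n :
  chi_nonzeros (m + n) = (chi_nonzeros m + \sum_(i < n) (chi (m + i) != 0))%N.
Proof. by rewrite /chi_nonzeros big_split_ord. Qed.

(** The block identities miss the last place of each block, which is counted here as 1; three blocks
    give the constant 3 below. *)
Lemma sum_bool_leS (n : nat) (F : nat -> bool) : (0 < n)%N ->
  (\sum_(i < n) F i <= (\sum_(i < n.-1) F i).+1)%N.
Proof.
by case: n => // n _; rewrite big_ord_recr /= -addn1 leq_add2l; case: (F n).
Qed.

Lemma chi_nonzeros_fib p :
  (chi_nonzeros (fib p.+4.+2) <=
   chi_nonzeros (fib p.+4.+1) + 2 * chi_nonzeros (fib p.+2) + 3)%N.
Proof.
rewrite (fibSS p.+4) chi_nonzerosD -addnA leq_add2l.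
have -> : fib p.+4 = (fib p.+2 + (fib p.+1 + fib p.+2))%N.
  by rewrite (fibSS p.+2) (fibSS p.+1); lia.
have split3 a b c (F : nat -> nat) : (\sum_(i < a + (b + c)) F i = \sum_(i < a) F i +
    (\sum_(i < b) F (a + i) + \sum_(i < c) F (a + (b + i))))%N.
  by rewrite !big_split_ord.
rewrite (split3 _ _ _ (fun i : nat => chi (fib p.+4.+1 + i) != 0 : nat)).
have hL : (\sum_(i < fib p.+2) (chi (fib p.+4.+1 + i) != 0) <=
           (chi_nonzeros (fib p.+2)).+1)%N.
  apply: leq_trans (sum_bool_leS (fun i => chi (fib p.+4.+1 + i) != 0) (fib_gt0 _)) _.
  rewrite ltnS; apply: leq_trans (chi_nonzeros_homo (leq_pred _)).
  (* The left block is a reversed copy, so the indices are reversed before comparing termwise. *)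
  rewrite /chi_nonzeros [X in (_ <= X)%N](reindex_inj rev_ord_inj) /=.
  apply: leq_sum => i _; rewrite (@chi_left_block p i ((fib p.+2).-1 - i.+1)).
    by rewrite mulf_eq0 signr_eq0.
  by have := ltn_ord i; lia.
have hM : (\sum_(i < fib p.+1) (chi (fib p.+4.+1 + (fib p.+2 + i)) != 0) <= 1)%N.
  apply: leq_trans
    (sum_bool_leS (fun i => chi (fib p.+4.+1 + (fib p.+2 + i)) != 0) (fib_gt0 _)) _.
  rewrite ltnS big1 // => i _.
  rewrite (@chi_middle_block p i ((fib p.+1).-1 - i.+1)) ?eqxx //.
  by have := ltn_ord i; lia.
have hR : (\sum_(i < fib p.+2) (chi (fib p.+4.+1 + (fib p.+2 + (fib p.+1 + i))) != 0)
           <= (chi_nonzeros (fib p.+2)).+1)%N.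
  apply: leq_trans (sum_bool_leS
    (fun i => chi (fib p.+4.+1 + (fib p.+2 + (fib p.+1 + i))) != 0) (fib_gt0 _)) _.
  rewrite ltnS; apply: leq_trans (chi_nonzeros_homo (leq_pred _)).
  apply: leq_sum => i _; rewrite [(fib p.+2 + _)%N]addnA -fibSS.
  rewrite (@chi_right_block p i ((fib p.+2).-1 - i.+1)) //.
  by have := ltn_ord i; lia.
by apply: leq_trans (leq_add hL (leq_add hM hR)) _; lia.
Qed.

(** * Growth rates and the limit *)

Lemma chi_nonzeros_le n : (chi_nonzeros n <= n)%N.
Proof.
rewrite /chi_nonzeros -[leqRHS]card_ord -sum1_card.
by apply: leq_sum => i _; case: (_ != _).
Qed.

Lemma chi_zerosE k : (chi_zeros k + chi_nonzeros k.+1 = k.+1)%N.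
Proof.
rewrite /chi_zeros -sum1_card big_mkcond /chi_nonzeros -big_split /=.
rewrite -[RHS]card_ord -sum1_card; apply: eq_bigr => i _.
by rewrite inE; case: (_ == _).
Qed.

(* 31/20 exceeds the root 1.54... of x^4 = x^3 + 2. *)
Lemma chi_nonzeros_growth (R : realType) n :
  (2 * chi_nonzeros (fib n) + 3)%:R <= 19 * (31 / 20) ^+ n :> R.
Proof.
elim/ltn_ind: n => n IH.
(* For n < 6 the count is at most f_5 = 8, and 19 = 2 * 8 + 3. *)
have [hn|hn] := ltnP n 6.
  have h8 : (chi_nonzeros (fib n) <= 8)%N.
    apply: leq_trans (chi_nonzeros_le _) _.
    exact: (@fib_homo n 5).
  apply: (@le_trans _ _ 19); first by rewrite ler_nat; lia.
  by rewrite ler_peMr // exprn_ege1 //; lra.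
case: n hn IH => [|[|[|[|[|[|p]]]]]] // _ IH.
have h5 := IH p.+4.+1 (leqnn _); have h2 := IH p.+2 ltac:(lia).
(* Passing from a to 2 a + 3 makes the recursive inequality homogeneous. *)
have : (2 * chi_nonzeros (fib p.+4.+2) + 3)%:R <=
  (2 * chi_nonzeros (fib p.+4.+1) + 3)%:R + 2 * (2 * chi_nonzeros (fib p.+2) + 3)%:R :> R.
  rewrite -natrM -natrD ler_nat; have := chi_nonzeros_fib p; lia.
have hx : 0 <= (31 / 20 : R) ^+ p by apply: exprn_ge0; lra.
move: h5 h2; rewrite !exprS; set x := _ ^+ p in hx *; lra.
Qed.

(** The induction rests on (8/5)^2 <= 8/5 + 1; the factor 5/8 gives equality at n = 1. *)
Lemma fib_growth (R : realType) n : 5 / 8 * (8 / 5) ^+ n <= (fib n)%:R :> R.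
Proof.
elim/ltn_ind: n => [[|[|n]]] IH; [|by rewrite expr1 (_ : fib 1 = 1%N) //; lra|].
  by rewrite expr0 (_ : fib 0 = 1%N) //; lra.
have h0 := IH n ltac:(lia); have h1 := IH n.+1 ltac:(lia).
have hx : 0 <= (8 / 5 : R) ^+ n by apply: exprn_ge0; lra.
rewrite fibSS natrD; move: h0 h1; rewrite !exprS; set x := _ ^+ n in hx *; lra.
Qed.

Lemma fib_bracket M k : (fib M <= k)%N ->
  exists m, [/\ (M <= m)%N, (fib m <= k)%N & (k < fib m.+1)%N].
Proof.
move=> hM; have bnd m : (fib m <= k)%N -> (m <= k)%N by exact: leq_trans (leq_fib m).
case: (ex_maxnP (ex_intro _ M hM) bnd) => m hm max_m.
exists m; split=> //; first exact: max_m.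
by rewrite ltnNge; apply/negP => /max_m; rewrite ltnn.
Qed.

Theorem theorem5p3 (R : realType) :
  (fun k : nat => (chi_zeros k)%:R / k%:R : R) @ \oo --> (1 : R).
Proof.
apply/cvgrPdist_le => /= e e0.
(* The ratio 31/32 is (31/20) / (8/5), and 48 exceeds 19 * (31/20) * (8/5). *)
have : (fun n => 48 * (31 / 32) ^+ n : R) @ \oo --> (0 : R).
  rewrite -[0](mulr0 48); apply: cvgMr; apply: cvg_expr.
  by rewrite ger0_norm; lra.
move/cvgrPdist_le => /(_ e e0) [M _ hM].
exists (fib M) => // k /= hk; have [m [Mm mk km]] := fib_bracket hk.
have := hM m Mm; rewrite sub0r normrN ger0_norm; last first.
  by rewrite mulr_ge0 // exprn_ge0 //; lra.
apply: le_trans.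
have k0 : 0 < k%:R :> R by rewrite ltr0n (leq_trans (fib_gt0 m)).
(* The -1 appears because k + 1 integers are counted but the division is by k. *)
have -> : 1 - (chi_zeros k)%:R / k%:R = ((chi_nonzeros k.+1)%:R - 1) / k%:R :> R.
  have : (chi_zeros k)%:R + (chi_nonzeros k.+1)%:R = k%:R + 1 :> R.
    by rewrite -natrD chi_zerosE natr1.
  move=> /(canRL (addrK _)) ->; field; exact: lt0r_neq0.
rewrite normrM normfV (gtr0_norm k0) ler_pdivrMr //.
have hn : (chi_nonzeros k.+1)%:R <= (chi_nonzeros (fib m.+1))%:R :> R.
  by rewrite ler_nat chi_nonzeros_homo.
have := chi_nonzeros_growth R m.+1; rewrite natrD natrM exprS => hg.
have hf : 5 / 8 * (8 / 5) ^+ m <= k%:R :> R.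
  by apply: le_trans (fib_growth R m) _; rewrite ler_nat.
have hq : 0 <= (31 / 32 : R) ^+ m by apply: exprn_ge0; lra.
have hE : (31 / 20 : R) ^+ m = (31 / 32) ^+ m * (8 / 5) ^+ m.
  by rewrite -exprMn; congr (_ ^+ _); lra.
have : (31 / 32) ^+ m * (5 / 8 * (8 / 5) ^+ m) <= (31 / 32) ^+ m * k%:R :> R.
  exact: ler_wpM2l.
have n0 : 0 <= (chi_nonzeros k.+1)%:R :> R by [].
move: hg; rewrite hE => hg hm.
rewrite ler_norml; apply/andP; split; lra.
Qed.
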